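(* Let $f \in \mathbb{Z}[X]$ be a monic quadratic polynomial with roots $\alpha,\beta$ such that $\alpha\beta = -1$ and $\alpha/\beta$ is not a root of unity, and let $g \in \mathbb{Z}[X]$ be a monic polynomial with $f \mid g$. Then $m \in \mathfrak{M}(g)$ for every integer $m \ge 7$ with $m \ne 10$ and $4 \nmid m$.
   Context: For a nonconstant monic polynomial $g(X) = X^r - c_1X^{r-1} - \cdots - c_r \in \mathbb{Z}[X]$, an integer linear recurrence with characteristic polynomial $g$ is an integer sequence $(s_n)_{n\ge 0}$ with $s_n = c_1 s_{n-1} + \cdots + c_r s_{n-r}$ for all $n \ge r$ (arbitrary integer initial conditions $s_0,\dots,s_{r-1}$). $\mathfrak{M}(g)$ is the set of positive integers $m$ for which there exist integer initial conditions and a positive integer $M$ such that the resulting recurrence takes exactly $m$ distinct residues modulo $M$. *)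

(* Defs.v *)
From mathcomp Require Export all_boot all_order all_algebra all_field.

Set Implicit Arguments.
Unset Strict Implicit.
Unset Printing Implicit Defensive.

Import GRing.Theory.
Local Open Scope ring_scope.

Definition degree (g : {poly int}) : nat := (size g).-1.

(* g = X^r - c_1 X^(r-1) - ... - c_r, so c_i is minus the coefficient of
   X^(r - i); meaningful for g monic and 1 <= i <= r. *)
Definition rec_coef (g : {poly int}) (i : nat) : int := - g`_(degree g - i).

(* Since n >= r and i <= r, the subtraction n - i on nat does not truncate. *)
Definition linear_recurrence (g : {poly int}) (s : nat -> int) : Prop :=
  forall n : nat, (degree g <= n)%N ->
    s n = \sum_(1 <= i < (degree g).+1) rec_coef g i * s (n - i)%N.

Definition takes_residues (s : nat -> int) (M m : nat) : Prop :=
  exists l : seq int,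
    [/\ uniq l, size l = m
      & forall x : int, x \in l <-> exists n : nat, x = (s n %% M%:Z)%Z].

(* The free initial values s_0, ..., s_(r-1) are subsumed by the choice of s. *)
Definition frakM (g : {poly int}) (m : nat) : Prop :=
  (0 < m)%N /\
  exists (s : nat -> int) (M : nat),
    [/\ linear_recurrence g s, (0 < M)%N & takes_residues s M m].

(* Main.v *)
(** Write f = X^2 - cX - 1 with c = eta a, where eta is a sign and a >= 1, and
    let U and V be the Lucas sequences with U_(n+2) = a U_(n+1) + U_n. For odd k,
    modulo V_k = U_(k+1) + U_(k-1) one has U_(k+d) = (-1)^d U_(k-d), hence
    U_(n+2k) = U_n. Thus s_n = eta^n (U_(n+k) + delta U_n), for a sign delta,
    satisfies s_(n+k) = eta delta s_n, and its terms with 0 <= d < k reduce to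
    +- U_(k-d) +- U_d. These have pairwise distinct nonzero absolute values less
    than V_k / 2, so s takes k residues if delta = eta and 2k residues if
    delta = - eta. *)

Require Import Defs.
From mathcomp Require Import all_boot all_order all_algebra all_field.
From mathcomp Require Import zify ring.

Set Implicit Arguments.
Unset Strict Implicit.
Unset Printing Implicit Defensive.

Import GRing.Theory.
Local Open Scope ring_scope.

(** * Growth and separation of the Lucas numbers U *)

Fixpoint lucasU (a n : nat) : nat :=
  match n with
  | 0 => 0
  | n1.+1 => match n1 with 0 => 1 | n2.+1 => a * lucasU a n1 + lucasU a n2 end%N
  end.

Arguments lucasU : simpl never.

Lemma lucasU0 (a : nat) : lucasU a 0 = 0%N. Proof. by []. Qed.

Lemma lucasU1 (a : nat) : lucasU a 1 = 1%N. Proof. by []. Qed.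

Lemma lucasUSS (a n : nat) :
  lucasU a n.+2 = (a * lucasU a n.+1 + lucasU a n)%N.
Proof. by []. Qed.

Lemma lucasU_gt0 (a n : nat) : (0 < a)%N -> (0 < n)%N -> (0 < lucasU a n)%N.
Proof.
move=> a0; elim/ltn_ind: n => [[|[|n]]] IH // _.
by rewrite lucasUSS; have := IH n.+1 (ltnSn _) isT; nia.
Qed.

Lemma lucasU_leS (a n : nat) : (0 < a)%N -> (lucasU a n <= lucasU a n.+1)%N.
Proof. by move=> a0; case: n => // n; rewrite lucasUSS; nia. Qed.

Lemma lucasU_ltS (a n : nat) :
  (0 < a)%N -> (1 < n)%N -> (lucasU a n < lucasU a n.+1)%N.
Proof.
move=> a0; case: n => // n n1; rewrite lucasUSS.
by have := @lucasU_gt0 a n a0 n1; nia.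
Qed.

Lemma lucasU_le (a m n : nat) :
  (0 < a)%N -> (m <= n)%N -> (lucasU a m <= lucasU a n)%N.
Proof.
move=> a0; elim: n => [|n IH]; first by rewrite leqn0 => /eqP->.
rewrite leq_eqVlt => /orP[/eqP-> //|]; rewrite ltnS => /IH h.
exact: leq_trans h (lucasU_leS n a0).
Qed.

Lemma lucasU_lt (a m n : nat) :
  (0 < a)%N -> (1 < m)%N -> (m < n)%N -> (lucasU a m < lucasU a n)%N.
Proof.
move=> a0 m1 mn; apply: leq_trans (@lucasU_ltS a m a0 m1) _.
exact: lucasU_le.
Qed.

(** For a >= 2 the term a U_j alone supplies 2 U_j. For a = 1 the gap U_(j+1) - U_j is U_(j-1), to
    be compared with U_i + U_(i-1) = U_(i+1), whence the demand i + 2 < j. *)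
Lemma lucasU_add_lt (a i j : nat) :
  (0 < a)%N -> (0 < i)%N -> (i < j)%N -> (1 < a)%N || (i.+2 < j)%N ->
  (lucasU a j + lucasU a i + lucasU a i.-1 < lucasU a j.+1)%N.
Proof.
move=> a0 i0 ij h; case: i j i0 ij h => // i [|j] // _ ij h; rewrite lucasUSS /=.
have l1 := @lucasU_le a i.+1 j a0 ij.
have l2 := lucasU_leS i a0.
have l3 := lucasU_leS j a0.
case: (ltnP 1 a) h => [a1 _|a1 /= h].
  have l4 := @lucasU_gt0 a j.+1 a0 isT.
  have l5 := @lucasU_lt a i.+1 j.+1 a0.
  have : (lucasU a i.+1 + lucasU a i < lucasU a j.+1 + lucasU a j)%N.
    case: i ij l1 l2 l5 => [|i] ij l1 l2 l5; last by have := l5 isT ij; lia.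
    case: j ij l1 l3 l4 {l5} => // j _ l1 l3 l4; by move: l1; rewrite lucasU0 !lucasU1; lia.
  have l6 : (2 * lucasU a j.+1 <= a * lucasU a j.+1)%N.
    by rewrite leq_mul2r a1 orbT.
  by lia.
have l4 := @lucasU_lt a i.+2 j a0 isT h.
have e1 : a = 1%N by lia.
by move: l4; rewrite lucasUSS e1; rewrite e1 in l1 l2 l3; lia.
Qed.

(** Separates U_(k-j) +- U_j from U_(k-i) +- U_i for all choices of signs at once: U_i <= U_(j-1)
    and U_(k-j+1) <= U_(k-i) reduce it to [lucasU_add_lt]. *)
Lemma lucasU_split_lt (a i j k : nat) :
  (0 < a)%N -> (i < j)%N -> (j + j < k)%N -> (1 < a)%N || (j + j + 2 < k)%N ->
  (lucasU a (k - j) + lucasU a j + lucasU a i < lucasU a (k - i))%N.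
Proof.
move=> a0 ij jk h.
have l1 : (0 < j)%N by lia.
have l2 : (j < k - j)%N by lia.
have l3 : (1 < a)%N || (j.+2 < k - j)%N by lia.
have := lucasU_add_lt a0 l1 l2 l3.
have := @lucasU_le a i j.-1 a0 ltac:(lia).
have := @lucasU_le a (k - j).+1 (k - i) a0 ltac:(lia).
lia.
Qed.

Lemma lucasU_split_neq (a i j k : nat) (b c : bool) :
  (0 < a)%N -> odd k -> (4 < k)%N -> (i < j)%N -> (j + j < k)%N ->
  (if b then lucasU a (k - i) + lucasU a i else lucasU a (k - i) - lucasU a i)%N
  <> (if c then lucasU a (k - j) + lucasU a j
      else lucasU a (k - j) - lucasU a j)%N.
Proof.
move=> a0 ok k4 ij jk.
case: (boolP ((1 < a)%N || (j + j + 2 < k)%N)) => [h|].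
  by have := lucasU_split_lt a0 ij jk h; case: b; case: c; lia.
(* The case left is a = 1, k = 2j + 1, where the ranges for j and i = j - 1 overlap. U is then the
   Fibonacci sequence and U_(j+1) +- U_j are again Fibonacci numbers, U_(j+2) and U_(j-1). *)
rewrite negb_or -!leqNgt => /andP[a1 kj].
have {a1} -> : a = 1%N by lia.
case: j ij jk kj => // j ij jk kj.
have -> : (k - j.+1 = j.+2)%N by lia.
(* Here 4 < k is essential: for k = 3 one has j = 0 after the shift, and U_3 +- U_0 = U_2 + U_1. *)
have gj := @lucasU_gt0 1%N j isT ltac:(lia).
have gj1 := lucasU_leS j (isT : (0 < 1)%N).
have lj := lucasUSS 1%N j.
have lj1 := lucasUSS 1%N j.+1.
case: (ltnP i j) => [ij'|ij'].
  have l1 := @lucasU_le 1%N j.+4 (k - i) isT ltac:(lia).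
  have l2 := @lucasU_le 1%N i j isT ltac:(lia).
  have lj2 := lucasUSS 1%N j.+2.
  by case: b; case: c; lia.
have -> : i = j by lia.
have -> : (k - j = j.+3)%N by lia.
by case: b; case: c; lia.
Qed.

(** * Absolute values of the reduced terms *)

(* The absolute value of (-1)^d U_(k-d) + delta U_d, where b says whether
   delta = 1; the two truncated differences add up to the absolute
   difference. *)
Definition folded (a k : nat) (b : bool) (d : nat) : nat :=
  if b (+) odd d then (lucasU a (k - d) + lucasU a d)%N
  else ((lucasU a (k - d) - lucasU a d) + (lucasU a d - lucasU a (k - d)))%N.

(** Exchanging d and k - d preserves the sum and the absolute difference, so the smaller index may
    be used, which makes the truncated subtraction exact; the choice between the two still depends
    on the parity of d itself. *)
Lemma foldedE (a k : nat) (b : bool) (d : nat) :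
  (0 < a)%N -> odd k -> (d < k)%N ->
  let i := minn d (k - d) in let e := (b (+) odd d) in
  folded a k b d = if e then (lucasU a (k - i) + lucasU a i)%N
                        else (lucasU a (k - i) - lucasU a i)%N.
Proof.
move=> a0 ok dk i e; rewrite /folded -/e.
case: (ltnP d (k - d)) => h.
  have -> : i = d by rewrite /i; lia.
  have := @lucasU_le a d (k - d) a0 ltac:(lia).
  by case: e; lia.
have -> : i = (k - d)%N by rewrite /i; lia.
have -> : (k - (k - d) = d)%N by lia.
have := @lucasU_le a (k - d)%N d a0 ltac:(lia).
by case: e; lia.
Qed.

(** Different smaller indices are separated by [lucasU_split_neq]. Otherwise e = k - d, which has
    the other parity since k is odd, so one value is a sum and the other a difference, 2 U_i apart
    with i > 0. *)
Lemma folded_inj (a k : nat) (b : bool) (d e : nat) :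
  (0 < a)%N -> odd k -> (4 < k)%N -> (d < k)%N -> (e < k)%N ->
  folded a k b d = folded a k b e -> d = e.
Proof.
move=> a0 ok k4 dk ek; rewrite !foldedE //=.
case: (ltngtP (minn d (k - d)) (minn e (k - e))) => h E.
- by case: (@lucasU_split_neq a _ _ k _ _ a0 ok k4 h ltac:(lia) E).
- by case: (@lucasU_split_neq a _ _ k _ _ a0 ok k4 h ltac:(lia) (esym E)).
case: (eqVneq d e) => // de.
have ed : (e = k - d)%N by lia.
have oe : odd e = ~~ odd d by lia.
have := @lucasU_gt0 a (minn d (k - d)) a0 ltac:(lia).
have := @lucasU_le a (minn d (k - d)) (k - minn d (k - d)) a0 ltac:(lia).
by move: E; rewrite oe -h; case: b; case: (odd d) => /=; lia.
Qed.

(** Every value is at most U_k, and 2 U_k < V_k = a U_k + 2 U_(k-1); for a = 1 this is U_(k-2) <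
    U_(k-1). *)
Lemma folded_bounds (a k : nat) (b : bool) (d : nat) :
  (0 < a)%N -> odd k -> (4 < k)%N -> (d < k)%N ->
  (0 < folded a k b d)%N /\
  (folded a k b d + folded a k b d < lucasU a k.+1 + lucasU a k.-1)%N.
Proof.
move=> a0 ok k4 dk; rewrite foldedE //=.
set i := minn d (k - d).
have ik : (i + i < k)%N by rewrite /i; lia.
move: i ik => i ik.
case: k ok k4 dk ik => [|[|k]] // ok k4 dk ik; rewrite lucasUSS.
have g1 := @lucasU_gt0 a k a0 ltac:(lia).
have g2 := @lucasU_ltS a k a0 ltac:(lia).
have dlt : (lucasU a i < lucasU a (k.+2 - i))%N.
  case: (ltnP 1 i) => i1; first by apply: lucasU_lt => //; lia.
  have := @lucasU_le a i 2%N a0 ltac:(lia).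
  by have := @lucasU_lt a 2%N (k.+2 - i)%N a0 isT ltac:(lia); lia.
have sle : (lucasU a (k.+2 - i) + lucasU a i <= lucasU a k.+2)%N.
  case: (posnP i) => i0; first by rewrite i0 subn0 addn0.
  have := @lucasU_le a (k.+2 - i)%N k.+1 a0 ltac:(lia).
  have := @lucasU_le a i k a0 ltac:(lia).
  by rewrite [lucasU a k.+2]lucasUSS; nia.
have key : (lucasU a k.+2 + lucasU a k.+2
            < a * lucasU a k.+2 + lucasU a k.+1 + lucasU a k.+1)%N.
  case: (ltnP 1 a) => a1; first by nia.
  have e1 : a = 1%N by lia.
  by rewrite [lucasU a k.+2]lucasUSS; move: g1 g2; rewrite e1; lia.
by rewrite /=; case: ifP => _; lia.
Qed.

(** * Congruences modulo V_k *)

Definition lucasV (a k : nat) : nat := (lucasU a k.+1 + lucasU a k.-1)%N.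

(** As functions of d, U_(k+d) and (-1)^d U_(k-d) obey the same recurrence. They agree at d = 0, and
    at d = 1 they differ by V_k. *)
Lemma lucasU_reflect (a k d : nat) : (0 < k)%N -> (d <= k)%N ->
  ((lucasV a k)%:Z %|
     (lucasU a (k + d))%:Z - (-1) ^+ d * (lucasU a (k - d))%:Z)%Z.
Proof.
move=> k0; elim/ltn_ind: d => [[|[|d]]] IH dk.
- by rewrite addn0 subn0 expr0 mul1r subrr dvdz0.
- by rewrite addn1 subn1 expr1 mulN1r opprK -PoszD dvdzz.
have /dvdzP[q0 E0] := IH d (ltnW (ltnSn _)) (ltnW (ltnW dk)).
have /dvdzP[q1 E1] := IH d.+1 (ltnSn _) (ltnW dk).
apply/dvdzP; exists (a%:Z * q1 + q0).
have e : (k - d = (k - d.+2).+2)%N by lia.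
have e' : (k - d.+1 = (k - d.+2).+1)%N by lia.
move: E0 E1; rewrite e e' !addnS !lucasUSS !PoszD !PoszM mulrDl -mulrA => <- <-.
by rewrite !exprS; ring.
Qed.

(** Reflection at d = k and d = k - 1 gives U_(2k) = 0 and, k being odd, U_(2k-1) = 1 modulo V_k.
    Hence U_(2k+1) = 1, and the recurrence propagates the period. *)
Lemma lucasU_period (a k n : nat) : odd k ->
  ((lucasV a k)%:Z %| (lucasU a (n + (k + k)))%:Z - (lucasU a n)%:Z)%Z.
Proof.
move=> ok; have k0 : (0 < k)%N by lia.
have H0 := @lucasU_reflect a k k k0 (leqnn _).
have H1 := @lucasU_reflect a k k.-1 k0 (leq_pred _).
elim/ltn_ind: n => [[|[|n]]] IH.
- by move: H0; rewrite subnn lucasU0 mulr0 !subr0.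
- case/dvdzP: H0 => q0 E0; case/dvdzP: H1 => q1 E1.
  apply/dvdzP; exists (a%:Z * q0 + q1).
  move: E0 E1; case: k ok k0 {IH} => // k ok _.
  rewrite subnn lucasU0 mulr0 subr0 /= subSnn lucasU1 mulr1.
  have -> : (-1) ^+ k = 1 :> int by rewrite -signr_odd; move: ok => /= /negbTE->.
  rewrite !addSn !addnS !add0n !lucasUSS !PoszD !PoszM mulrDl -mulrA => <- <-.
  by ring.
case/dvdzP: (IH n (ltnW (ltnSn _))) => q0 E0.
case/dvdzP: (IH n.+1 (ltnSn _)) => q1 E1.
apply/dvdzP; exists (a%:Z * q1 + q0).
move: E0 E1; rewrite !addSn !lucasUSS !PoszD !PoszM mulrDl -mulrA => <- <-.
by ring.
Qed.

(** * The sequence s and its terms modulo V_k *)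

Definition twisted (a k : nat) (eta delta : int) (n : nat) : int :=
  eta ^+ n * ((lucasU a (n + k))%:Z + delta * (lucasU a n)%:Z).

Definition is_sign (x : int) : Prop := x = 1 \/ x = -1.

Lemma is_signM (x y : int) : is_sign x -> is_sign y -> is_sign (x * y).
Proof. by move=> [->|->] [->|->]; [left|right|right|left]. Qed.

Lemma is_signX (x : int) (n : nat) : is_sign x -> is_sign (x ^+ n).
Proof.
by move=> sx; elim: n => [|n IH]; [left | rewrite exprS; apply: is_signM].
Qed.

Lemma is_sign_sqr (x : int) : is_sign x -> x * x = 1.
Proof. by case=> ->. Qed.

Lemma twisted_rec (a k : nat) (eta delta : int) (n : nat) : is_sign eta ->
  twisted a k eta delta n.+2
  = eta * a%:Z * twisted a k eta delta n.+1 + twisted a k eta delta n.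
Proof.
move=> se; rewrite /twisted !addSn !lucasUSS !PoszD !PoszM !exprS.
have e2 := is_sign_sqr se.
have -> : forall x : int, eta * (eta * eta ^+ n) * x = (eta * eta) * eta ^+ n * x.
  by move=> x; ring.
have -> : forall x : int, eta * a%:Z * (eta * eta ^+ n * x)
   = (eta * eta) * a%:Z * eta ^+ n * x by move=> x; ring.
by rewrite e2; ring.
Qed.

(** By periodicity U_(n+2k) + delta U_(n+k) becomes U_n + delta U_(n+k), which is delta (U_(n+k) +
    delta U_n); and eta^k = eta for odd k. *)
Lemma twisted_shift (a k : nat) (eta delta : int) (n : nat) :
  odd k -> is_sign eta -> is_sign delta ->
  ((lucasV a k)%:Z %| twisted a k eta delta (n + k)
                      - (eta * delta) * twisted a k eta delta n)%Z.
Proof.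
move=> ok se sd; case/dvdzP: (@lucasU_period a k n ok) => q E.
apply/dvdzP; exists (eta ^+ (n + k) * q).
rewrite -[RHS]mulrA -E /twisted addnA exprD.
have -> : eta ^+ k = eta.
  by case: se => ->; rewrite ?expr1n // -signr_odd ok.
have d2 := is_sign_sqr sd.
have -> : forall x y z : int,
  eta * delta * (x * (y + delta * z)) = eta * x * (delta * y + delta * delta * z).
  by move=> x y z; ring.
by rewrite d2; ring.
Qed.

Lemma twisted_folded (a k : nat) (eta delta : int) (d : nat) :
  (0 < k)%N -> (d < k)%N -> is_sign eta -> is_sign delta ->
  exists2 tau : int, is_sign tau &
    ((lucasV a k)%:Z %| twisted a k eta delta d
                        - tau * (folded a k (delta == 1) d)%:Z)%Z.
Proof.
move=> k0 dk se sd.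
have H := @lucasU_reflect a k d k0 (ltnW dk).
have sE := is_signX d se.
(* Reflection replaces U_(d+k) by (-1)^d U_(k-d); what remains is an integer equal to its absolute
   value up to sign. *)
suff [t st Et] : exists2 t : int, is_sign t &
    (-1) ^+ d * (lucasU a (k - d))%:Z + delta * (lucasU a d)%:Z
    = t * (folded a k (delta == 1) d)%:Z.
  exists (eta ^+ d * t); first exact: is_signM.
  rewrite -mulrA -Et /twisted -mulrBr [(d + k)%N]addnC; apply: dvdz_mull.
  by rewrite opprD addrACA subrr addr0.
rewrite /folded -signr_odd.
set x := lucasU a (k - d); set y := lucasU a d.
case: sd => -> /=; case: (odd d) => /=; rewrite ?expr0 ?expr1.
- case: (leqP x y) => h; [exists 1; first by left | exists (-1); first by right]; lia.
- exists 1; first by left. lia.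
- exists (-1); first by right. lia.
case: (leqP x y) => h; [exists (-1); first by right | exists 1; first by left]; lia.
Qed.

(** The sign sigma treats coincidences s_d = s_e and s_d = - s_e together; the latter matter when s
    changes sign under the shift by k. *)
Lemma twisted_inj (a k : nat) (eta delta sigma : int) (d e : nat) :
  (0 < a)%N -> odd k -> (4 < k)%N -> (d < k)%N -> (e < k)%N ->
  is_sign eta -> is_sign delta -> is_sign sigma ->
  ((lucasV a k)%:Z %| twisted a k eta delta d
                      - sigma * twisted a k eta delta e)%Z ->
  d = e /\ sigma = 1.
Proof.
move=> a0 ok k4 dk ek se sd ss H.
have k0 : (0 < k)%N by lia.
have [t st Ht] := @twisted_folded a k eta delta d k0 dk se sd.
have [u su Hu] := @twisted_folded a k eta delta e k0 ek se sd.
have [pd bd] := @folded_bounds a k (delta == 1) d a0 ok k4 dk.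
have [pe be] := @folded_bounds a k (delta == 1) e a0 ok k4 ek.
have fi := @folded_inj a k (delta == 1) d e a0 ok k4 dk ek.
case/dvdzP: H => q E; case/dvdzP: Ht => q1 E1; case/dvdzP: Hu => q2 E2.
move: fi pd bd pe be E1 E2; rewrite -/(lucasV a k).
set x := folded _ _ _ _; set y := folded _ _ _ _; set V := lucasV a k in E *.
move=> fi pd bd pe be E1 E2.
have E3 : t * x%:Z - sigma * u * y%:Z = (q - q1 + sigma * q2) * V%:Z.
  by rewrite mulrDl mulrBl -[sigma * q2 * _]mulrA -E -E1 -E2; ring.
(* Both x and y are below V / 2, so the left side of [E3] is a multiple of V smaller than V in
   absolute value. *)
have Q0 : q - q1 + sigma * q2 = 0.
  move: (q - q1 + _) E3 => r E3.
  case: st E3 => ->; case: ss => ->; case: su => -> E3; nia.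
move: E3; rewrite Q0 mul0r => E3.
have xy : x = y by case: st E3 => ->; case: ss => ->; case: su => ->; lia.
split; first exact: fi.
have de := fi xy; case: ss E3 => // -> E3.
exfalso.
(* For sigma = -1, [E3] gives t = - u. But d = e, so t x and u x represent the same term, and the
   size bound gives t = u. *)
have : t * x%:Z - u * y%:Z = (q2 - q1) * V%:Z.
  by rewrite mulrBl -E1 -E2 de; ring.
rewrite -xy in E3 *.
move=> E4; have Q2 : q2 - q1 = 0.
  move: (q2 - q1) E4 => r E4.
  case: st E4 {E3} => ->; case: su => -> E4; nia.
move: E4; rewrite Q2 mul0r => E4.
by case: st E3 E4 => ->; case: su => ->; lia.
Qed.

(** * Counting residues over one period *)

Lemma takes_residues_of_period (s : nat -> int) (M p : nat) :
  (0 < p)%N ->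
  (forall n, (M%:Z %| s (n + p)%N - s n)%Z) ->
  (forall i j, (i < p)%N -> (j < p)%N -> (M%:Z %| s i - s j)%Z -> i = j) ->
  takes_residues s M p.
Proof.
move=> p0 per inj; exists [seq (s i %% M%:Z)%Z | i <- iota 0 p]; split.
- rewrite map_inj_in_uniq ?iota_uniq // => i j.
  rewrite !mem_iota !add0n /= => ip jp E; apply: inj => //.
  by rewrite -eqz_mod_dvd E.
- by rewrite size_map size_iota.
move=> x; split=> [/mapP[i _ ->]|[n ->]]; first by exists i.
have -> : (s n %% M%:Z = s (n %% p)%N %% M%:Z)%Z.
  rewrite {1}(divn_eq n p); move: (n %/ p)%N => q; elim: q => [|q IH] //.
  rewrite -IH mulSnr addnAC; apply/eqP.
  by rewrite eqz_mod_dvd per.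
by apply: map_f; rewrite mem_iota /= add0n ltn_mod.
Qed.

Lemma twisted_residues (a k : nat) (eta : int) :
  (0 < a)%N -> odd k -> (4 < k)%N -> is_sign eta ->
  takes_residues (twisted a k eta eta) (lucasV a k) k.
Proof.
move=> a0 ok k4 se; apply: takes_residues_of_period => [|n|i j ik jk H].
- by lia.
- by have := @twisted_shift a k eta eta n ok se se; rewrite is_sign_sqr // mul1r.
by case: (@twisted_inj a k eta eta 1 i j) => //; [left | rewrite mul1r].
Qed.

Lemma twisted_residues_double (a k : nat) (eta : int) :
  (0 < a)%N -> odd k -> (4 < k)%N -> is_sign eta ->
  takes_residues (twisted a k eta (- eta)) (lucasV a k) (k + k).
Proof.
move=> a0 ok k4 se.
have sd : is_sign (- eta) by case: se => ->; [right|left].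
have shift n : ((lucasV a k)%:Z %| twisted a k eta (- eta) (n + k)
                                   + twisted a k eta (- eta) n)%Z.
  by have := @twisted_shift a k eta (- eta) n ok se sd;
     rewrite mulrN is_sign_sqr // mulN1r opprK.
have inj1 i j : (i < k)%N -> (j < k)%N ->
    ((lucasV a k)%:Z %| twisted a k eta (- eta) i - twisted a k eta (- eta) j)%Z ->
    i = j.
  move=> ik jk H.
  by case: (@twisted_inj a k eta (- eta) 1 i j) => //; [left | rewrite mul1r].
have injN i j : (i < k)%N -> (j < k)%N ->
    ((lucasV a k)%:Z %| twisted a k eta (- eta) i + twisted a k eta (- eta) j)%Z ->
    False.
  move=> ik jk H.
  case: (@twisted_inj a k eta (- eta) (-1) i j) => //; first by right.
  by rewrite mulN1r opprK.
apply: takes_residues_of_period => [|n|i j ik jk H].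
- by lia.
- rewrite addnA.
  have -> : twisted a k eta (- eta) (n + k + k) - twisted a k eta (- eta) n =
    (twisted a k eta (- eta) (n + k + k) + twisted a k eta (- eta) (n + k)) -
    (twisted a k eta (- eta) (n + k) + twisted a k eta (- eta) n) by ring.
  by apply: rpredB; apply: shift.
(* Indices from k on are brought below k at the cost of a sign. Equal signs reduce to [inj1];
   opposite signs give s_i = - s_j, excluded by [injN]. *)
case: (ltnP i k) => ik'; case: (ltnP j k) => jk'.
- exact: inj1.
- case: (injN i (j - k)%N) => //; first by lia.
  have := shift (j - k)%N; rewrite subnK // => H2.
  by have := rpredD H H2; rewrite addrA subrK.
- case: (injN (i - k)%N j) => //; first by lia.
  have := shift (i - k)%N; rewrite subnK // => H2.
  by have := rpredB H2 H; rewrite opprB addrC addrA subrK addrC.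
have := shift (j - k)%N; have := shift (i - k)%N; rewrite !subnK // => H2 H3.
suff : (i - k = j - k)%N by lia.
apply: inj1; [lia|lia|].
have := rpredB (rpredB H2 H3) H.
by set x := twisted _ _ _ _ _; set y := twisted _ _ _ _ _;
   set z := twisted _ _ _ _ _; set w := twisted _ _ _ _ _;
   have -> : x + y - (z + w) - (x - z) = y - w by ring.
Qed.

(** * Recurrences of multiples of f *)

Lemma linear_recurrence_dvd (f q : {poly int}) (c : int) (s : nat -> int) :
  f = 'X^2 - c *: 'X - 1 -> q * f \is monic ->
  (forall n, s n.+2 = c * s n.+1 + s n) ->
  linear_recurrence (q * f) s.
Proof.
move=> fE gm rec.
(* For N >= [size p], this is p evaluated at the shift operator, applied to s at n. The free cutoff
   N lets polynomials of different sizes share one range of summation. *)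
pose L (N : nat) (p : {poly int}) (n : nat) := \sum_(j < N) p`_j * s (n + j)%N.
have Lwiden N (p : {poly int}) n : (size p <= N)%N -> L N p n = L (size p) p n.
  move=> le; rewrite /L -(subnKC le) big_split_ord /= [X in _ + X]big1 ?addr0 // => j _.
  by rewrite nth_default ?mul0r // leq_addr.
have L0 n : L (size (q * f)) (q * f) n = 0.
  elim/poly_ind: q {gm} n => [|q b IH] n.
    by rewrite mul0r /L big1 // => j _; rewrite coef0 mul0r.
  (* Large enough for the three coefficients of f, and for those of q f after multiplication by
     X. *)
  set N' := (size (q * f)).+4.
  rewrite -(@Lwiden (maxn N' (size ((q * 'X + b%:P) * f)))) ?leq_maxr //.
  set K := maxn _ _; have KN : (N' <= K)%N by apply: leq_maxl.
  have -> : L K ((q * 'X + b%:P) * f) n = L K (q * f * 'X) n + b * L K f n.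
    rewrite /L mulr_sumr -big_split /=; apply: eq_bigr => j _.
    by rewrite mulrDl mul_polyC -mulrA -commr_polyX mulrA coefD coefZ mulrDl mulrA.
  have -> : L K f n = 0.
    have : (3 <= K)%N by apply: leq_trans KN.
    case: K {KN} => [|[|[|K]]] // _.
    rewrite /L !big_ord_recl big1 => [|j _]; last first.
      by rewrite fE !coefB coefXn coefZ coefX coef1 /= mulr0 !subr0 mul0r.
    rewrite fE !coefB !coefXn !coefZ !coefX !coef1 /=.
    rewrite /bump /= addn0 addn1 addn2 rec; ring.
  rewrite mulr0 addr0; have [K' KE] : exists K', K = K'.+1.
    by case: K KN => // K' _; exists K'.
  rewrite KE /L big_ord_recl coefMX eqxx mul0r add0r.
  under eq_bigr => j _ do rewrite coefMX /= /bump /= add1n /= addnS -addSn.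
  rewrite -/(L K' (q * f) n.+1) Lwiden ?IH //.
  by move: KN; rewrite KE /N'; lia.
move=> n le; set r := degree (q * f) in le *.
have sz : size (q * f) = r.+1.
  by rewrite /r /degree prednK // lt0n size_poly_eq0 monic_neq0.
(* At n - r the leading coefficient 1 multiplies s_n; solving for s_n and reversing the sum gives
   the recurrence. *)
have := L0 (n - r)%N; rewrite sz /L big_ord_recr /=.
have -> : (q * f)`_r = 1 by move/monicP: gm; rewrite lead_coefE.
rewrite mul1r subnK // => /eqP; rewrite addrC addr_eq0 => /eqP->.
rewrite big_add1 /= big_mkord -sumrN (reindex_inj rev_ord_inj) /=.
apply: eq_bigr => i _; rewrite /rec_coef -/r mulNr; congr (- (_ * s _)).
by have := ltn_ord i; lia.
Qed.

Theorem theorem1p3 (f g : {poly int}) (alpha beta : algC)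
    (f_monic : f \is monic) (f_quadratic : degree f = 2%N)
    (f_roots : map_poly (intr : int -> algC) f
               = ('X - alpha%:P) * ('X - beta%:P))
    (prod_roots : alpha * beta = -1)
    (ratio_not_unity :
       forall n : nat, (0 < n)%N -> ~ n.-unity_root (alpha / beta))
    (g_monic : g \is monic)
    (f_dvd_g : exists q : {poly int}, g = q * f)
    (m : nat) (m_ge7 : (7 <= m)%N) (m_neq10 : m <> 10%N)
    (m_not4 : ~~ (4 %| m)%N) :
  frakM g m.
Proof.
have size_f : size f = 3%N by move: f_quadratic; rewrite /degree; lia.
have f2 : f`_2 = 1 by move/monicP: f_monic; rewrite lead_coefE size_f.
have coef_roots i : (f`_i)%:~R = (('X - alpha%:P) * ('X - beta%:P))`_i :> algC.
  by rewrite -f_roots coef_map.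
have f0 : f`_0 = -1.
  apply/eqP; rewrite -(eqr_int algC) coef_roots coef0M !coefB !coefX !coefC /=.
  by rewrite !sub0r mulrNN prod_roots.
(* A vanishing trace would give alpha / beta = -1, a square root of unity. Hence a >= 1 below. *)
have f1 : f`_1 != 0.
  apply/eqP => f1.
  have := coef_roots 1%N; rewrite f1 coefM !big_ord_recl big_ord0 /bump /=.
  rewrite !coefB !coefX !coefC /= !subr0 !sub0r mulr1 mul1r addr0.
  move/eqP; rewrite eq_sym addr_eq0 opprK => /eqP ab.
  have b0 : beta != 0.
    apply/eqP => b0; move: prod_roots; rewrite b0 mulr0 => /eqP.
    by rewrite eq_sym oppr_eq0 oner_eq0.
  apply: (ratio_not_unity 2%N) => //; apply/unity_rootP.
  have -> : alpha = - beta by rewrite -ab opprK.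
  by rewrite mulNr divff // sqrrN expr1n.
set c := - f`_1.
have fE : f = 'X^2 - c *: 'X - 1.
  apply/polyP => -[|[|[|i]]]; rewrite !coefB coefXn coefZ coefX coef1 /=.
  - by rewrite f0 mulr0 subr0 sub0r.
  - by rewrite mulr1 subr0 sub0r opprK.
  - by rewrite f2 mulr0 !subr0.
  by rewrite mulr0 !subr0 nth_default // size_f.
pose a := `|c|%N; pose eta : int := Num.sg c.
have a0 : (0 < a)%N by rewrite /a /c; lia.
have se : is_sign eta by rewrite /eta /is_sign /c; lia.
have cE : c = eta * a%:Z by rewrite /eta /a; lia.
case: f_dvd_g => q gE; rewrite gE in g_monic *.
have rec k delta : linear_recurrence (q * f) (twisted a k eta delta).
  apply: (linear_recurrence_dvd fE) => // n; rewrite cE; exact: twisted_rec.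
split; first by lia.
case: (boolP (odd m)) => om.
  exists (twisted a m eta eta), (lucasV a m); split=> //.
    by have := @lucasU_gt0 a m.+1 a0 isT; rewrite /lucasV; lia.
  by apply: twisted_residues => //; lia.
(* As 4 does not divide m, m/2 is odd, and m >= 7 then makes it at least 5. *)
have mE : m = (m./2 + m./2)%N by lia.
exists (twisted a m./2 eta (- eta)), (lucasV a m./2); split=> //.
  by have := @lucasU_gt0 a m./2.+1 a0 isT; rewrite /lucasV; lia.
by rewrite [X in takes_residues _ _ X]mE; apply: twisted_residues_double => //; lia.
Qed.
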